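(* There exists a Mrówka space $X$ for which $P(X)$ is not pseudocompact.
   Context: A Tychonoff space $X$ is called a Mrówka space if (1) the set of isolated points of $X$ is countable and dense in $X$; (2) the set of nonisolated points of $X$ is discrete; (3) $|\beta X\setminus X|=1$, where $\beta X$ is the Stone–Čech compactification of $X$. For a Tychonoff space $X$, $P(X)$ is the set of Radon probability measures on the Borel $\sigma$-algebra of $X$ (for every Borel $B$ and $\varepsilon>0$ there is a compact $K\subset B$ with $\mu(B\setminus K)<\varepsilon$), with the weak topology, i.e. the topology generated by the functions $\mu\mapsto\int_X f\,d\mu$ for bounded continuous $f:X\to\mathbb R$. A space is pseudocompact if every continuous real-valued function on it is bounded. *)

(* Defs.v *)
From HB Require Import structures.
From mathcomp Require Import all_boot all_order all_algebra.
From mathcomp Require Import all_classical all_reals all_analysis.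

Set Implicit Arguments.
Unset Strict Implicit.
Unset Printing Implicit Defensive.

Import Order.TTheory GRing.Theory Num.Theory.
Import numFieldNormedType.Exports.

Local Open Scope classical_set_scope.
Local Open Scope ring_scope.

Definition tychonoff_space (X : topologicalType) : Prop :=
  completely_regular_space X /\ hausdorff_space X.

Definition pseudocompact (R : realType) (X : topologicalType) : Prop :=
  forall f : X -> R, continuous f -> bounded_fun f.

Definition discrete_subset (X : topologicalType) (D : set X) : Prop :=
  forall A : set (set_type D), open A.

Section stone_cech.
Context (R : realType) (X : topologicalType).

Definition cont_unit : set (X -> R) :=
  [set f : X -> R | continuous f /\ range f `<=` `[0, 1]].

Definition stone_cech_eval (x : X) : {ptws set_type cont_unit -> R} :=
  fun f => set_val f x.

(* For X Tychonoff, stone_cech_eval is an embedding of X into the cube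
   [0, 1]^C(X, [0, 1]), and beta X is the closure of its image. *)
Definition stone_cech : set {ptws set_type cont_unit -> R} :=
  closure (range stone_cech_eval).

End stone_cech.

Definition mrowka_space (R : realType) (X : topologicalType) : Prop :=
  [/\ tychonoff_space X,
      countable (isolated [set: X]) /\ dense (isolated [set: X]),
      discrete_subset (~` isolated [set: X]) &
      exists p, @stone_cech R X `\` range (@stone_cech_eval R X) = [set p]].

(* measurableType requires a distinguished point, hence ptopologicalType; this
   only excludes the empty space, which is not a Mrowka space. *)
Definition borel (X : ptopologicalType) : Type :=
  g_sigma_algebraType (@open X).

HB.instance Definition _ (X : ptopologicalType) := Measurable.on (borel X).

Section radon_probability.
Context (R : realType) (X : ptopologicalType).

Definition radon (mu : set X -> \bar R) : Prop :=
  forall B : set (borel X), measurable B -> forall e : R, 0 < e ->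
  exists K : set X, [/\ compact K, K `<=` B & (mu (B `\` K) < e%:E)%E].

(* A [probability] also has values on non-measurable sets; setting them to 0
   makes two elements equal as soon as they agree on the Borel sets. *)
Definition is_radon_probability : set (probability (borel X) R) :=
  [set mu | radon mu /\
            forall B : set (borel X), ~ measurable B -> mu B = 0%E].

Definition radon_probability : Type := set_type is_radon_probability.

Definition cont_bounded : set (X -> R) :=
  [set f : X -> R | continuous f /\ bounded_fun f].

Definition radon_integral (f : X -> R) (mu : radon_probability) : R :=
  \int[set_val mu]_x f x.

HB.instance Definition _ := Choice.on radon_probability.

HB.instance Definition _ := Topological.copy radon_probability
  (sup_topology (fun f : set_type cont_bounded =>
    Topological.class (initial_topology (radon_integral (set_val f))))).

End radon_probability.

(* Main.v *)
(* Glue a MAD family on the binary tree out of branches. Start from the branches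
   of the tree together with a family M of selectors (sets with at most one node
   on each level) that is maximal almost disjoint modulo the branches. Each member
   of the final family is a union of at most two branches and two members of M,
   every branch and every member of M being used once. If f is continuous on the
   resulting Psi-space, with limit F(x) along the branch x, then {F < s} and
   {F > t} are contained in F_sigma sets on which F <= s, resp. F >= t; such sets
   are countable or of cardinality continuum. There are only continuum many pairs
   of them, so one can choose, injectively, a branch in each set of each pair and
   glue the two branches: this forces F to be constant up to countably many
   branches. By maximality of the family, f is then within any e > 0 of this
   constant off a compact set. Hence the Stone-Cech remainder is a point.

   All members of the family are unions of at most four selectors, so the uniform
   measures on the levels of the tree give every compact set asymptotically no
   mass; suitable neighbourhoods of them form a locally finite sequence of open
   sets in P(X), which carries an unbounded continuous function. *)
From HB Require Import structures.
Require Import Defs.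
From mathcomp Require Import all_boot all_order all_algebra.
From mathcomp Require Import all_classical all_reals all_analysis.
From mathcomp Require Import ring lra.

Set Implicit Arguments.
Unset Strict Implicit.
Unset Printing Implicit Defensive.

Import Order.TTheory GRing.Theory Num.Theory.
Import numFieldNormedType.Exports.

Local Open Scope classical_set_scope.
Local Open Scope card_scope.

(** * Distinct representatives and perfect sets *)

Lemma card_leT_injP T U (B : set U) :
  [set: T] #<= B <-> exists f : T -> U, injective f /\ forall x, B (f x).
Proof.
split=> [/card_leP[f]|[f [finj fB]]].
  exists (fun x => val (f (SigSub (mem_setT x)))); split=> [x y /val_inj/inj xy|x].
    by have /(congr1 val) := xy (mem_set I) (mem_set I).
  exact/set_mem/valP.
apply: (@card_le_trans _ _ _ (f @` setT)).
  have /card_eqPle[] // : f @` setT #= [set: T].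
  by apply: inj_card_eq => x y _ _; exact: finj.
by apply: subset_card_le => _ [x _ <-].
Qed.

(** Transfinite recursion along a well-founded order in which [J] does not inject into the
    predecessors of any point: the values chosen before stage [j] cannot exhaust [P j]. *)
Lemma distinct_representatives (J : eqType) (T : Type) (P : J -> set T) :
  (forall j, [set: J] #<= P j) ->
  exists g : J -> T, injective g /\ forall j, P j (g j).
Proof.
move=> leP; have [R Rwo] := wochoice.well_ordering_principle J.
have Rmin (A : set J) : A !=set0 -> exists2 z, A z & forall x, A x -> R z x.
  move=> [x Ax]; have [|z [[Az zmin] _]] := Rwo [pred x | `[< A x >]].
    by exists x; rewrite unfold_in; apply/asboolP.
  exists z; first by move: Az; rewrite unfold_in => /asboolP.
  by move=> y Ay; apply: zmin; rewrite unfold_in; apply/asboolP.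
have Ranti x y : R x y -> R y x -> x = y.
  have Rxx z : R z z by have [_ ->] := Rmin [set z] (ex_intro _ z erefl); apply.
  move=> xy yx; have [|z [_ zuniq]] := Rwo [pred z | (z == x) || (z == y)].
    by exists x; rewrite unfold_in /= eqxx.
  rewrite -(zuniq x) ?(zuniq y) //; split; rewrite ?unfold_in /= ?eqxx ?orbT //.
  - by move=> ?; rewrite unfold_in => /orP[] /eqP ->.
  - by move=> ?; rewrite unfold_in => /orP[] /eqP ->.
pose below a := [set x | R x a /\ x <> a].
(* The well-order will be pulled back along [h]. If some initial segment is as large as [J], [h]
   injects [J] into the least such segment, whose points all have smaller segments below them;
   otherwise [h] is the identity. *)
have [h [hinj hsmall]] : exists h : J -> J,
    injective h /\ forall j, ~ ([set: J] #<= below (h j)).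
  have [[a aJ]|noa] := pselect (exists a, [set: J] #<= below a); last first.
    by exists id; split=> // j jJ; apply: noa; exists j.
  have [b Jb bmin] : exists2 b, [set: J] #<= below b &
      forall x, [set: J] #<= below x -> R b x.
    by apply: (Rmin [set x | [set: J] #<= below x]); exists a.
  have /card_leT_injP[f [finj fb]] := Jb.
  exists f; split=> // j /bmin bj; have [jb jb'] := fb j.
  by apply: jb'; exact: Ranti.
pose lt i j := R (h i) (h j) /\ h i <> h j.
have ltwf : well_founded lt.
  move=> j; apply: contrapT => nj.
  have [|_ [i ni <-] imin] := Rmin (h @` [set i | ~ Acc lt i]).
    by exists (h j); exists j.
  apply: ni; constructor => k [ki ki']; apply: contrapT => nk.
  by apply: ki'; apply: Ranti => //; apply: imin; exists k.
have ltsmall j : ~ ([set: J] #<= [set i | lt i j]).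
  move=> le; apply: (hsmall j); apply: card_le_trans le _.
  have : h @` [set i | lt i j] #= [set i | lt i j].
    by apply: inj_card_eq => x y _ _; exact: hinj.
  move=> /card_eqPle[_]; move=> /card_le_trans; apply.
  by apply: subset_card_le => _ [i [? ?] <-].
have Pne j : exists t, P j t.
  by have /card_leT_injP[f [_ fP]] := leP j; exists (f j).
(* The fallback branch only makes the recursion total; [gP] rules it out by means of [ltsmall]. *)
pose G j (rec : forall i, lt i j -> T) : T :=
  match pselect (exists t, P j t /\ forall i (l : lt i j), rec i l <> t) with
  | left e => sval (cid e)
  | right _ => sval (cid (Pne j))
  end.
pose g := Fix ltwf (fun=> T) G.
have gE j : g j = G j (fun i _ => g i).
  rewrite /g Fix_eq // => x f1 f2 f12; congr G.
  by apply: functional_extensionality_dep => i; apply: functional_extensionality_dep.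
have gP j : P j (g j) /\ forall i, lt i j -> g i <> g j.
  rewrite gE /G; case: pselect => [e|ne]; first by case: cid.
  exfalso; apply: (ltsmall j); apply: card_le_trans (leP j) _.
  apply: (@card_le_trans _ _ _ (g @` [set i | lt i j])); last exact: card_image_le.
  apply: subset_card_le => t Pt; apply: contrapT => nt; apply: ne.
  by exists t; split=> // i l it; apply: nt; exists i.
exists g; split; last by move=> j; have [] := gP j.
move=> i j gij; apply: contrapT => ij.
have hij : h i <> h j by move/hinj.
have Rtot : R (h i) (h j) \/ R (h j) (h i).
  have [|_ [->|->] m] := Rmin [set h i; h j]; first by exists (h i); left.
  - by left; apply: m; right.
  - by right; apply: m; left.
case: Rtot => r.
- by have [_ /(_ i)] := gP j; apply.
- by have [_ /(_ j)] := gP i; apply=> //; split=> // /esym.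
Qed.

(** An F_sigma subset of the Cantor space, coded by a set of nodes. There are only continuum many
    codes, which is what allows distinct representatives for all pairs of them. *)
Definition prefixes_in (U : set (seq bool)) : set (nat -> bool) :=
  [set x | exists n, forall m, (n <= m)%N -> U (mkseq x m)].

Definition cylinder (s : seq bool) : set (nat -> bool) :=
  [set x | mkseq x (size s) = s].

Lemma take_mkseq T (x : nat -> T) n m :
  (n <= m)%N -> take n (mkseq x m) = mkseq x n.
Proof. by move=> nm; rewrite /mkseq -map_take take_iota (minn_idPl nm). Qed.

(** Consider the points of [C] in the cylinder all of whose cylinders meet [C] in an uncountable
    set. Two of them would give a splitting at the end of their longest common prefix. So without a
    splitting there is at most one ([Z]), and the other points lie in countably many countable
    pieces. *)
Lemma uncountable_closed_split (C : set (nat -> bool)) (s : seq bool) :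
  ~ countable (C `&` cylinder s) ->
  exists t, [/\ prefix s t, ~ countable (C `&` cylinder (rcons t false)) &
                ~ countable (C `&` cylinder (rcons t true))].
Proof.
move=> big; apply: contrapT => nt; apply: big.
pose Z := [set x | (C `&` cylinder s) x /\
  forall m, ~ countable (C `&` cylinder (mkseq x m))].
have Z1 x y : Z x -> Z y -> x = y.
  move=> [[Cx sx] Zx] [[Cy sy] Zy]; apply: contrapT => xy.
  have [n nxy] : exists n, x n != y n.
    by apply: contrapT => ne; apply: xy; apply/funext => n;
      apply/eqP/negP => /negP ?; apply: ne; exists n.
  case: (ex_minnP (ex_intro (fun n => x n != y n) n nxy)) => {nxy}k kxy kmin.
  have xyk : mkseq x k = mkseq y k.
    apply/eq_in_map => i; rewrite mem_iota add0n /= => ik.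
    by apply/eqP; apply: contraTT ik => /kmin; rewrite leqNgt.
  have sk : (size s <= k)%N.
    rewrite leqNgt; apply/negP => ks; move/eqP: kxy; apply.
    rewrite -(nth_mkseq false x ks) -(nth_mkseq false y ks).
    by rewrite sx sy.
  apply: nt; exists (mkseq x k); split.
  - by rewrite -sx -(take_mkseq _ sk) prefix_take.
  - have := Zx k.+1; have := Zy k.+1; rewrite !mkseqS -xyk.
    by move: kxy; case: (x k) (y k) => [] [].
  - have := Zx k.+1; have := Zy k.+1; rewrite !mkseqS -xyk.
    by move: kxy; case: (x k) (y k) => [] [].
pose F o := if o is Some t then C `&` cylinder t else Z.
apply: (@sub_countable _ _ _ (\bigcup_(o in [set o | countable (F o)]) F o)).
  apply: subset_card_le => x Cx.
  have [Zx|nZx] := pselect (Z x).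
    exists None => //=.
    apply: (@sub_countable _ _ _ [set x]); last exact: countable1.
    by apply: subset_card_le => y Zy; exact: Z1.
  have [m cm] : exists m, countable (C `&` cylinder (mkseq x m)).
    by apply: contrapT => nm; apply: nZx; split=> // m cm; apply: nm; exists m.
  exists (Some (mkseq x m)) => //; split; first by case: Cx.
  by rewrite /cylinder /= size_mkseq.
by apply: bigcup_countable => //; exact: countableP.
Qed.

(** The perfect set theorem by a Cantor scheme: repeated splitting yields nested nodes [psi x n]
    with uncountable cylinders, steered by the bits of [x]. Their limit [H x] determines [x], and it
    lies in [C] because the hypothesis says that [C] is closed. *)
Lemma countable_or_cantor_closed (C : set (nat -> bool)) :
  (forall x, (forall m, C `&` cylinder (mkseq x m) !=set0) -> C x) ->
  countable C \/ [set: nat -> bool] #<= C.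
Proof.
move=> clC; have [|big0] := pselect (countable C); [by left|right].
pose big s := ~ countable (C `&` cylinder s).
have /choice[f fP] s : exists t, big s ->
    [/\ prefix s t, big (rcons t false) & big (rcons t true)].
  have [/uncountable_closed_split[t tP]|] := pselect (big s); first by exists t.
  by exists s.
pose psi x := fix psi n := if n is n'.+1 then rcons (f (psi n')) (x n') else [::].
have psiS x n : psi x n.+1 = rcons (f (psi x n)) (x n) by [].
have psi_big x n : big (psi x n).
  elim: n => [|n /fP[_ b0 b1]]; last by rewrite psiS; case: (x n).
  by move=> c; apply: big0; apply: sub_countable c; apply: subset_card_le.
have psi_pre x n : prefix (psi x n) (f (psi x n)) by have [] := fP _ (psi_big x n).
have psi_size x n : (size (psi x n) < size (psi x n.+1))%N.
  by rewrite psiS size_rcons ltnS; exact: size_prefix.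
have le_size x n : (n <= size (psi x n))%N.
  by elim: n => // n IH; apply: leq_ltn_trans IH (psi_size x n).
have psi_take x n m : (n <= m)%N -> take (size (psi x n)) (psi x m) = psi x n.
  move=> nm; apply/eqP; rewrite -prefixE; elim: m nm => [|m IH].
    by rewrite leqn0 => /eqP ->.
  rewrite leq_eqVlt => /orP[/eqP ->|nm]; first exact: prefix_refl.
  apply: prefix_trans (IH nm) (prefix_trans (psi_pre x m) _).
  by rewrite psiS prefix_rcons.
(* [psi x k.+1] has length at least [k.+1], so the default of [nth] is never read. *)
pose H x k := nth false (psi x k.+1) k.
have HE x n : mkseq (H x) (size (psi x n)) = psi x n.
  apply: (@eq_from_nth _ false); first by rewrite size_mkseq.
  move=> k; rewrite size_mkseq => kn; rewrite nth_mkseq // /H.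
  have [nk|kn'] := leqP n k.+1.
    by rewrite -[in RHS](psi_take x _ _ nk) nth_take.
  by rewrite -[in LHS](psi_take x _ _ (ltnW kn')) nth_take.
have CH x : C (H x).
  apply: clC => m.
  have [y [Cy ym]] : C `&` cylinder (psi x m) !=set0.
    apply: contrapT => ne; apply: (psi_big x m).
    apply: (@sub_countable _ _ _ set0); last exact: countable0.
    by apply: subset_card_le => y Cy; apply: ne; exists y.
  exists y; split=> //; rewrite /cylinder /= size_mkseq.
  rewrite -(take_mkseq _ (le_size x m)) -(take_mkseq (H x) (le_size x m)).
  by rewrite ym HE.
have Hinj : injective H.
  move=> x y Hxy.
  have psixy n : psi x n = psi y n -> x n = y n.
    move=> nE; have := HE x n.+1; have := HE y n.+1.
    rewrite !psiS !size_rcons nE -Hxy => -> /eqP.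
    by rewrite eqseq_rcons => /andP[_ /eqP].
  have xy n : psi x n = psi y n.
    by elim: n => // n IH; rewrite !psiS IH (psixy _ IH).
  by apply/funext => n; exact: psixy.
by apply/card_leT_injP; exists H.
Qed.

(** [prefixes_in U] is the union of the closed sets [C n]: either all of them are countable, or one
    is at least as large as the Cantor space. *)
Lemma countable_or_cantor (U : set (seq bool)) :
  countable (prefixes_in U) \/ [set: nat -> bool] #<= prefixes_in U.
Proof.
pose C n := [set x : nat -> bool | forall m, (n <= m)%N -> U (mkseq x m)].
have UE : prefixes_in U = \bigcup_n C n.
  by apply/seteqP; split=> x [n] => [nx|_ nx]; exists n.
have [cC|] := pselect (forall n, countable (C n)).
  by left; rewrite UE; apply: bigcup_countable.
move=> /existsNP[n Cn].
have [|/Cn//|le] := @countable_or_cantor_closed (C n).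
  move=> x xm m nm; have [y [Cy]] := xm m.
  by rewrite /cylinder /= size_mkseq => <-; exact: Cy.
right; apply: card_le_trans le _; apply: subset_card_le => x Cx.
by rewrite UE; exists n.
Qed.

(** * The almost disjoint family *)

Definition branch (x : nat -> bool) : set (seq bool) := range (mkseq x).

Definition selector (M : set (seq bool)) :=
  forall s t, M s -> M t -> size s = size t -> s = t.

Definition thin (D : set (seq bool)) :=
  exists k, forall n, (#|[pred t : n.-tuple bool | `[< D t >]]| <= k)%N.

Lemma thinU D E : thin D -> thin E -> thin (D `|` E).
Proof.
move=> [k Dk] [l El]; exists (k + l)%N => n.
apply: leq_trans (leq_add (Dk n) (El n)); rewrite -cardUI.
apply: leq_trans (leq_addr _ _); apply: subset_leq_card.
apply/fintype.subsetP => t; rewrite !unfold_in => /asboolP[Dt|Et]; apply/orP.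
  by left; apply/asboolP.
by right; apply/asboolP.
Qed.

Lemma selector_thin M : selector M -> thin M.
Proof.
move=> sM; exists 1%N => n; apply/card_le1_eqP => s t; rewrite !unfold_in.
by move=> /asboolP Ms /asboolP Mt; apply: val_inj; apply: sM Mt Ms _; rewrite !size_tuple.
Qed.

Lemma finite_level n : finite_set [set s : seq bool | size s = n].
Proof.
have -> : [set s : seq bool | size s = n] = range (@tval n bool).
  apply/seteqP; split=> [s /= /eqP sn|_ [t _ <-]]; first by exists (Tuple sn).
  exact: size_tuple.
exact/finite_image/finite_finset.
Qed.

Lemma branch_selector x : selector (branch x).
Proof.
by move=> _ _ [n _ <-] [m _ <-]; rewrite !size_mkseq => ->.
Qed.

Lemma infinite_branch x : infinite_set (branch x).
Proof.
move=> /(finite_image size); apply: contra_not infinite_nat.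
by apply: sub_finite_set => n _; exists (mkseq x n); [exists n|rewrite size_mkseq].
Qed.

Lemma finite_branchI x y : x <> y -> finite_set (branch x `&` branch y).
Proof.
move=> xy; have [n nxy] : exists n, x n <> y n.
  apply: contrapT => ne; apply: xy; apply/funext => n.
  by apply: contrapT => ?; apply: ne; exists n.
apply: (@sub_finite_set _ _ (mkseq x @` `I_n.+1)); last exact/finite_image/finite_II.
move=> _ [[m _ <-] [k _ ykm]].
have mk : k = m by have := congr1 size ykm; rewrite !size_mkseq.
exists m => //=; rewrite ltnS leqNgt; apply/negP => nm; apply: nxy.
by rewrite -(nth_mkseq false x nm) -(nth_mkseq false y nm) -ykm mk.
Qed.

(** Levels are finite, so [D] meets infinitely many of them; take one node of [D] on each. *)
Lemma infinite_selector D : infinite_set D ->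
  exists D', [/\ D' `<=` D, infinite_set D' & selector D'].
Proof.
move=> Dinf; pose L := size @` D.
have /choice[c cP] n : exists s, L n -> D s /\ size s = n.
  have [[s Ds <-]|nL] := pselect (L n); [by exists s|by exists [::]].
have Linf : infinite_set L.
  move=> Lfin; apply: Dinf.
  apply: (@sub_finite_set _ _ (\bigcup_(n in L) [set s | size s = n])).
    by move=> s Ds; exists (size s) => //; exists s.
  by apply: bigcup_finite => // n _; exact: finite_level.
exists (c @` L); split.
- by move=> _ [n /cP[? _] <-].
- move=> /(finite_image size); apply: contra_not Linf.
  by apply: sub_finite_set => n Ln; have [_ sn] := cP n Ln; exists (c n) => //; exists n.
- by move=> _ _ [n /cP[_ sn] <-] [m /cP[_ sm] <-]; rewrite sn sm => ->.
Qed.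

Definition set_code (C : countType) (M : set C) : nat -> bool :=
  fun n => `[< exists2 s, pickle s = n & M s >].

Lemma set_code_inj (C : countType) : injective (@set_code C).
Proof.
move=> M M' MM'; apply/seteqP.
suff sub (N N' : set C) : set_code N = set_code N' -> N `<=` N' by split; exact: sub.
move=> NN' s Ns; have : set_code N (pickle s) by apply/asboolP; exists s.
by rewrite NN' => /asboolP[t /(pcan_inj pickleK) <-].
Qed.

(** Zorn's lemma. If an infinite [D] met every branch and every member in a finite set, an infinite
    selector inside [D] could be added to the family. *)
Lemma mad_selectors : exists F : set (set (seq bool)),
  [/\ forall M, F M -> selector M,
      forall M x, F M -> finite_set (M `&` branch x),
      forall M M', F M -> F M' -> M <> M' -> finite_set (M `&` M') &
      forall D, infinite_set D -> (exists x, infinite_set (branch x `&` D)) \/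
        exists2 M, F M & infinite_set (M `&` D)].
Proof.
pose P (F : set (set (seq bool))) :=
  [/\ forall M, F M -> selector M,
      forall M x, F M -> finite_set (M `&` branch x) &
      forall M M', F M -> F M' -> M <> M' -> finite_set (M `&` M')].
have [G GP Gtot|F [[F1 F2 F3] Fmax]] := @Zorn_bigcup _ P.
  split=> [M [X /GP[X1 _ _] /X1]|M x [X /GP[_ X2 _] XM]|M M' [X GX XM] [Y GY YM]] //.
    exact: X2.
  have [XY|YX] := Gtot X Y GX GY.
    by have [_ _ Y3] := GP Y GY; apply: Y3 => //; exact: XY.
  by have [_ _ X3] := GP X GX; apply: X3 => //; exact: YX.
exists F; split=> // D /infinite_selector[E [ED Einf Esel]].
apply: contrapT => /not_orP[nb nM].
have fin B : finite_set (B `&` D) -> finite_set (B `&` E).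
  by apply: sub_finite_set => s [Bs /ED].
have Eb x : finite_set (E `&` branch x).
  by rewrite setIC; apply: fin; apply: contrapT => ?; apply: nb; exists x.
have EM M : F M -> finite_set (M `&` E).
  by move=> FM; apply: fin; apply: contrapT => ?; apply: nM; exists M.
apply: (Fmax (F `|` [set E])).
  split; first by move=> M; left.
  by move=> /(_ E (or_intror erefl)) /EM; rewrite setIid.
split.
- by move=> M [/F1|->].
- by move=> M x [/F2|->].
- move=> M M' [FM|->] [FM'|->] // MM'; first exact: F3.
    exact: EM.
  by rewrite setIC; exact: EM.
Qed.

(** The indexing by branches is not injective: [A x = A y] for distinct [x] and [y] means that the
    two branches are glued into one member. The last clause provides glued pairs for any two
    uncountable coded sets. *)
Lemma mrowka_family : exists A : (nat -> bool) -> set (seq bool),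
  [/\ forall x, branch x `<=` A x /\ thin (A x),
      forall x y, A x <> A y -> finite_set (A x `&` A y),
      forall D, infinite_set D -> exists x, infinite_set (A x `&` D) &
      forall U V, ~ countable (prefixes_in U) -> ~ countable (prefixes_in V) ->
        exists x y, [/\ prefixes_in U x, prefixes_in V y & A x = A y]].
Proof.
have [F [Fsel Fbranch Fad Fmax]] := mad_selectors.
pose J := (set (seq bool) * set (seq bool))%type.
(* The value [setT] for countable [prefixes_in j.1] makes every [P j] large enough to choose
   representatives. *)
pose P (j : J) : set (nat -> bool) :=
  if `[< countable (prefixes_in j.1) >] then setT else prefixes_in j.1.
have leP j : [set: J] #<= P j.
  (* A pair of sets of nodes is one subset of a countable sum type, hence coded by a point of the
     Cantor space. *)
  apply: (@card_le_trans _ _ _ [set: nat -> bool]).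
    apply/card_leT_injP; exists (fun j => set_code
      [set c : seq bool + seq bool | match c with inl s => j.1 s | inr s => j.2 s end]).
    split=> // -[U V] [U' V'] /set_code_inj /= UV.
    congr pair; apply/funext => s.
      exact: (congr1 (fun D : set _ => D (inl s)) UV).
    exact: (congr1 (fun D : set _ => D (inr s)) UV).
  rewrite /P; case: asboolP => // nc.
  by have [] := countable_or_cantor j.1.
have [g [ginj gP]] := distinct_representatives leP.
pose swap (j : J) := (j.2, j.1).
(* An involution that exchanges the representatives of [(U, V)] and [(V, U)] and fixes all branches
   that are not representatives; branches in one orbit get glued. *)
pose sigma x := if pselect (exists j, g j = x) is left e
                then g (swap (sval (cid e))) else x.
have sigmag j : sigma (g j) = g (swap j).
  rewrite /sigma; case: pselect => [e|[]]; last by exists j.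
  by case: cid => /= k /ginj ->.
have sigmaK x : sigma (sigma x) = x.
  have [[j <-]|nj] := pselect (exists j, g j = x).
    by rewrite !sigmag; case: j.
  have sx : sigma x = x by rewrite /sigma; case: pselect.
  by rewrite !sx.
(* The member of [F] with code [x], or the empty set if there is none. Since codes are injective,
   each member is attached to exactly one branch. *)
pose m x := [set s | exists M, [/\ F M, set_code M = x & M s]].
have mE x : m x = set0 \/ exists M, [/\ F M, set_code M = x & m x = M].
  have [[M [FM Mx]]|nM] := pselect (exists M, F M /\ set_code M = x).
    right; exists M; split=> //; apply/seteqP; split=> s; last by exists M.
    by move=> [M' [_ + M's]]; rewrite -Mx => /set_code_inj <-.
  by left; rewrite -subset0 => s [M [FM Mx _]]; apply: nM; exists M.
pose B x := branch x `|` m x.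
have mbranch x y : finite_set (m x `&` branch y).
  by have [->|[M [FM _ ->]]] := mE x; [rewrite set0I|exact: Fbranch].
have BI x y : x <> y -> finite_set (B x `&` B y).
  move=> xy; rewrite /B setIUr !setIUl !finite_setU; split; split.
  - exact: finite_branchI.
  - exact: mbranch.
  - by rewrite setIC; exact: mbranch.
  - have [->|[M [FM Mx ->]]] := mE x; first by rewrite set0I.
    have [->|[M' [FM' My ->]]] := mE y; first by rewrite setI0.
    by apply: Fad => // MM'; apply: xy; rewrite -Mx -My MM'.
have Bthin x : thin (B x).
  apply: thinU; first exact/selector_thin/branch_selector.
  by apply: selector_thin; have [->|[M [/Fsel ? _ ->]]] := mE x.
exists (fun x => B x `|` B (sigma x)); split.
- move=> x; split; first by move=> s xs; left; left.
  exact: thinU.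
- move=> x y xy; have nxy : x <> y by move=> e; apply: xy; rewrite e.
  have nxsy : x <> sigma y.
    by move=> e; apply: xy; rewrite e sigmaK setUC.
  rewrite (setIUr (B x `|` B (sigma x))) !(setIUl (B x) (B (sigma x))) !finite_setU.
  split; split; apply: BI => //.
    by move=> e; apply: nxsy; rewrite -e sigmaK.
  by move=> e; apply: nxy; rewrite -(sigmaK x) e sigmaK.
- move=> D /Fmax[[x inf]|[M FM inf]].
    exists x; apply: sub_infinite_set inf; apply: setSI => s xs.
    by left; left.
  exists (set_code M); apply: sub_infinite_set inf; apply: setSI => s Ms.
  by left; right; exists M.
- move=> U V Uc Vc; exists (g (U, V)), (g (V, U)); split.
  + by have := gP (U, V); rewrite /P; case: asboolP.
  + by have := gP (V, U); rewrite /P; case: asboolP.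
  + by rewrite !sigmag /= setUC.
Qed.

(** * Psi-spaces *)

Lemma finite_set_inj T U (f : T -> U) (A : set T) :
  {in A &, injective f} -> finite_set (f @` A) -> finite_set A.
Proof. by move=> /inj_card_eq /eq_finite_set ->. Qed.

(** The Mrowka-Isbell space of the family [a]: each [inl s] will be isolated, and neighbourhoods of
    [inr A] contain all but finitely many points of [a A]. The phantom parameter [a] lets the
    topology depend on the family. *)
Definition psi_space (N T : Type) (a : T -> set N) : Type := (N + T)%type.

Section psi_space_topology.
Context (N : countType) (T : choiceType) (a : T -> set N).
Local Notation X := (psi_space a).

Definition psi_open (U : set X) :=
  forall A, U (inr A) -> finite_set (a A `&` [set s | ~ U (inl s)]).

Let psi_openT : psi_open setT.
Proof.
by move=> A _; rewrite (_ : _ `&` _ = set0) // -subset0 => s [_]; apply.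
Qed.

Let psi_openI : setI_closed psi_open.
Proof.
move=> U V Uo Vo A [/Uo UA /Vo VA].
apply: sub_finite_set (_ : finite_set (_ `|` _)); last first.
  by rewrite finite_setU; split; [exact: UA|exact: VA].
by move=> s [As /not_andP[?|?]]; [left|right].
Qed.

Let psi_open_bigU (I : Type) (f : I -> set X) :
  (forall i, psi_open (f i)) -> psi_open (\bigcup_i f i).
Proof.
move=> fo A [i _ /fo]; apply: sub_finite_set => s [As nf]; split=> // fs.
by apply: nf; exists i.
Qed.

HB.instance Definition _ := Choice.copy X (N + T)%type.
HB.instance Definition _ :=
  isOpenTopological.Build X psi_openT psi_openI psi_open_bigU.

Lemma psi_openE (U : set X) : open U = psi_open U.
Proof. by []. Qed.

Definition psi_ball (x : X) : set X :=
  match x with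
  | inl s => [set inl s]
  | inr A => inr A |` (inl @` a A)
  end.

Context (ad : forall A B, A <> B -> finite_set (a A `&` a B)).
Context (inf : forall A, infinite_set (a A)).

Lemma open_psi_inl (U : set X) : U `<=` range inl -> open U.
Proof. by rewrite psi_openE => Ul A /Ul[]. Qed.

(** The complement is open because, for [B] other than [A], almost disjointness leaves only finitely
    many points of [a B] in [D]. *)
Lemma clopen_psi (A : T) (D : set N) :
  D `<=` a A -> finite_set (a A `\` D) -> clopen (inr A |` (inl @` D) : set X).
Proof.
move=> DA fin; split.
  rewrite psi_openE => B [[->]|[]] //; apply: sub_finite_set fin => s [As nD]; split=> //.
  by move=> Ds; apply: nD; right; exists s.
rewrite -[X in closed X]setCK; apply: open_closedC; rewrite psi_openE => B nB.
have AB : A <> B by move=> AB; apply: nB; left; rewrite AB.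
apply: sub_finite_set (ad AB) => s [Bs /contrapT [//|[t Dt [ts]]]].
by subst t; split=> //; exact: DA.
Qed.

Lemma clopen_psi_inl s : clopen [set inl s : X].
Proof.
split; first by apply: open_psi_inl => _ ->; exists s.
rewrite -[X in closed X]setCK; apply: open_closedC; rewrite psi_openE => B _.
apply: sub_finite_set (finite_set1 s) => t [_ /contrapT] /= [->]; exact: erefl.
Qed.

Lemma clopen_psi_ball x : clopen (psi_ball x).
Proof.
case: x => [s|A]; first exact: clopen_psi_inl.
by apply: clopen_psi => //; rewrite setDv; exact: finite_set0.
Qed.

Lemma psi_ball_refl x : psi_ball x x.
Proof. by case: x => [s|A] //; left. Qed.

Lemma psi_clopen_base (U : set X) x :
  open U -> U x -> exists W, [/\ clopen W, W x & W `<=` U].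
Proof.
case: x => [s|A] oU Ux.
  by exists [set inl s]; split=> //; [exact: clopen_psi_inl|move=> _ ->].
exists (inr A |` (inl @` (a A `&` [set s | U (inl s)]))); split.
- apply: clopen_psi; first by move=> s [].
  by apply: sub_finite_set (oU _ Ux) => s [As nU]; split=> // Us; apply: nU.
- by left.
- by move=> _ [->|[s [_ ?] <-]].
Qed.

Lemma hausdorff_psi : hausdorff_space X.
Proof.
rewrite open_hausdorff => x y /eqP xy.
have [||W [[oW cW] Wx Wy]] := @psi_clopen_base (~` [set y]) x; last 1 first.
- exists (W, ~` W) => /=.
    by split; apply: mem_set => // /Wy; apply.
  by split; [|exact: closed_openC|rewrite setICr].
- rewrite psi_openE => A _; apply: (@finite_set_inj _ _ inl); first by move=> ? ? _ _ [].
  apply: sub_finite_set (finite_set1 y) => _ [s [_ /contrapT <-] <-] //.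
- by move=> /= e; exact: xy.
Qed.

Lemma isolated_psi : isolated [set: X] = range inl.
Proof.
apply/seteqP; split=> [[s _|A]|_ [s _ <-]]; first by exists s.
- move=> [_ [V + VE]]; rewrite nbhsE => -[U [oU UA] UV].
  exfalso; apply: (inf (A := A)); apply: sub_finite_set (oU _ UA) => s As.
  split=> // Us; have : (V `&` setT) (inl s) by split=> //; exact: UV.
  by rewrite VE.
- split; first exact: mem_set.
  exists [set inl s]; last by rewrite setIT.
  by apply: open_nbhs_nbhs; split=> //; have [] := clopen_psi_inl s.
Qed.

Lemma dense_psi : dense (isolated [set: X]).
Proof.
rewrite isolated_psi => O [[s Os _|A OA oO]]; first by exists (inl s); split=> //; exists s.
have [s [_ Os]] : exists s, a A s /\ O (inl s).
  apply: contrapT => no; apply: (inf (A := A)); apply: sub_finite_set (oO _ OA) => s As.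
  by split=> // Os; apply: no; exists s.
by exists (inl s); split=> //; exists s.
Qed.

Lemma discrete_psi : discrete_subset (~` isolated [set: X]).
Proof.
move=> S; exists (range inl `|` set_val @` S).
  rewrite psi_openE => A _; apply: sub_finite_set (finite_set0 N) => s [_]; apply.
  by left; exists s.
apply/seteqP; split=> x; last by move=> Sx; right; exists x.
case=> [xl|[y Sy /val_inj <-]] //.
have : (~` isolated [set: X]) (set_val x) := set_valP x.
by case; move: (set_val x) xl => y; rewrite isolated_psi.
Qed.

(** A filter on the fan that does not cluster at [inr A] contains the part of the fan outside some
    neighbourhood of [inr A], and this part is finite. *)
Lemma compact_psi_fan A D : D `<=` a A -> compact (inr A |` (inl @` D) : set X).
Proof.
move=> DA F FF FD; have [cA|] := pselect (cluster F (inr A)).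
  by exists (inr A); split=> //; left.
move=> /existsNP[V /existsNP[U /not_implyP[FV /not_implyP[]]]].
rewrite nbhsE => -[P [oP PA] PU] VU.
have finG : finite_set ((inl @` D : set X) `&` ~` P).
  have := finite_image (inl : N -> X) (oP _ PA).
  apply: sub_finite_set => _ [[s Ds <-] nP]; exists s => //; split=> //; exact: DA.
have FG : F ((inl @` D) `&` ~` P).
  apply: filterS (filterI FV FD) => y [Vy Dy].
  have nPy : ~ P y by move=> /PU Uy; apply: VU; exists y.
  by split=> //; case: Dy => // yA; case: nPy; rewrite yA.
have [x [[xD _] cx]] := finite_compact finG FF FG.
by exists x; split=> //; right.
Qed.

Lemma compact_psi_ball x : compact (psi_ball x).
Proof. by case: x => [s|A]; [exact: compact_set1|exact: compact_psi_fan]. Qed.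

(** [K] is a finite union of fans together with the set [E] of its nodes outside these fans; the
    second hypothesis forces [E] to be finite. *)
Lemma compact_psi (K : set X) : finite_set [set A | K (inr A)] ->
  (forall D, infinite_set D -> (forall s, D s -> K (inl s)) ->
     exists2 A, K (inr A) & infinite_set (a A `&` D)) ->
  compact K.
Proof.
move=> finK Kinf; set S := [set A | K (inr A)] in finK.
pose E := [set s | K (inl s) /\ forall A, S A -> ~ a A s].
have finE : finite_set E.
  apply: contrapT => /Kinf[s []//|A KA]; apply.
  by rewrite (_ : _ `&` _ = set0) // -subset0 => s [As [_ /(_ A KA)]].
have -> : K = (inl @` E : set X) `|` \bigcup_(A in S)
    (inr A |` (inl @` (a A `&` [set s | K (inl s)]))).
  apply/seteqP; split=> [[s|A] Kx|x].
  - have [[A [KA As]]|nA] := pselect (exists A, S A /\ a A s).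
      by right; exists A => //; right; exists s.
    by left; exists s => //; split=> // A SA As; apply: nA; exists A.
  - by right; exists A => //; left.
  - by case=> [[s [Ks _] <-]|[A SA [->|[s [_ Ks] <-]]]].
apply: compactU; first exact (@finite_compact X _ (finite_image inl finE)).
rewrite -bigsetU_fset_set //; apply: bigsetU_compact => A _.
by apply: compact_psi_fan => s [].
Qed.

Context (mad : forall D, infinite_set D -> exists A, infinite_set (a A `&` D)).

(** * Continuous functions on Psi-spaces of maximal families *)

Section continuous_functions.
Local Open Scope ring_scope.
Context (R : realType) (f : X -> R) (cf : continuous f).

Lemma finite_psi_far A (e : R) : 0 < e ->
  finite_set (a A `&` [set s | e <= `|f (inl s) - f (inr A)|]).
Proof.
move=> e0; have oU : open (f @^-1` ball (f (inr A)) e).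
  by apply: open_comp; [move=> x _; exact: cf|exact: ball_open].
apply: sub_finite_set (oU A _); last exact: ballxx.
by move=> s [As es]; split=> //=; rewrite /ball /= distrC => /lt_geF; rewrite es.
Qed.

Lemma psi_infinite_near A D (e : R) : 0 < e -> infinite_set (a A `&` D) ->
  exists s, [/\ a A s, D s & `|f (inl s) - f (inr A)| < e].
Proof.
move=> e0 Dinf; apply: contrapT => no; apply: Dinf.
apply: sub_finite_set (finite_psi_far A e0) => s [As Ds]; split=> //=.
by rewrite leNgt; apply/negP => lt; apply: no; exists s.
Qed.

(* If infinitely many (but countably many) points [inr A] stayed far from [c],
   a set diagonalising against them would be almost disjoint from every [a A]. *)
Lemma finite_psi_far_countable (c : R) :
  (forall e, 0 < e -> countable [set A | e <= `|f (inr A) - c|]) ->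
  forall e, 0 < e -> finite_set [set A | e <= `|f (inr A) - c|].
Proof.
move=> cnt e e0; apply: contrapT => Ginf.
set G := [set A | _] in Ginf; pose H := [set A | e / 2 <= `|f (inr A) - c|].
have e4 : 0 < e / 4 by rewrite divr_gt0.
have /countable_injP[j jinj] : countable H by apply: cnt; rewrite divr_gt0.
(* The threshold of [B] keeps distance [e / 4] from those of [G] and [H]: for [A] in [G] almost all
   of [a A] lies in [B], and an [a A] that meets [B] infinitely often has [A] in [H]. *)
pose B := [set s | e * 3 / 4 <= `|f (inl s) - c|].
have BH A : infinite_set (a A `&` B) -> H A.
  move=> /(psi_infinite_near e4)[s [_ Bs fs]]; rewrite /H /=.
  have := ler_distD (f (inr A)) (f (inl s)) c; move: Bs fs; rewrite /B /=; lra.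
have GB A : G A -> finite_set (a A `&` ~` B).
  move=> GA; apply: sub_finite_set (finite_psi_far A e4) => s [As nB]; split=> //=.
  move/negP: nB; rewrite -ltNge => nB.
  have := ler_distD (f (inl s)) (f (inr A)) c; rewrite (distrC (f (inr A)) (f (inl s))).
  by move: GA nB; rewrite /G /=; lra.
pose Hn n := [set A | H A /\ (j A < n)%N].
have finHn n : finite_set (Hn n).
  apply: (@finite_set_inj _ _ j).
    by move=> A A' /set_mem[HA _] /set_mem[HA' _]; apply: jinj; exact: mem_set.
  by apply: sub_finite_set (finite_II n) => _ [A [_ ?] <-].
(* Such a point exists: for some [A] in [G] outside [Hn n], almost all of [a A] lies in [B] and
   outside the finitely many [a A'] with [A'] in [Hn n]. *)
have /choice[d dP] n : exists s, [/\ B s, (n <= pickle s)%N &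
    forall A, Hn n A -> ~ a A s].
  have [A [GA nA]] : (G `\` Hn n) !=set0.
    by apply: infinite_setN0; apply: infinite_setD.
  apply: contrapT => no; apply: (inf (A := A)).
  apply: (@sub_finite_set _ _ ((a A `&` ~` B) `|` ([set s : N | (pickle s < n)%N] `|`
    \bigcup_(A' in Hn n) (a A `&` a A')))).
    move=> s As; have [Bs|nB] := pselect (B s); last by left.
    right; have [sn|ns] := ltnP (pickle s) n; first by left.
    right; apply: contrapT => nA'; apply: no; exists s; split=> // A' HA' A's.
    by apply: nA'; exists A'.
  rewrite !finite_setU; split; [exact: GB|split].
    apply: (@finite_set_inj _ _ pickle).
      by move=> ? ? _ _; exact: (pcan_inj pickleK).
    by apply: sub_finite_set (finite_II n) => _ [s ? <-].
  apply: bigcup_finite => // A' HA'; apply: ad => AA'; apply: nA.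
  by rewrite AA'.
(* Maximality gives an [A] with [a A] meeting [range d] infinitely often. As [range d] lies in [B],
   this [A] is in [H]; but [d n] avoids [a A] once [n] exceeds [j A]. *)
have [|A AD] := mad (D := range d).
  move=> /(finite_image (@pickle N)) /finite_seqP[s sE].
  pose m := (\max_(i <- s) i)%N; have [_ ms _] := dP m.+1.
  have : pickle (d m.+1) \in s.
    suff : [set` s] (pickle (d m.+1)) by [].
    by rewrite -sE; exists (d m.+1) => //; exists m.+1.
  move=> ins; have : (pickle (d m.+1) <= m)%N by exact: leq_bigmax_seq.
  by rewrite leqNgt ms.
have HA : H A.
  apply: BH; apply: sub_infinite_set AD => s [As [n _ ds]]; split=> //.
  by rewrite -ds; have [] := dP n.
apply: AD; apply: (@sub_finite_set _ _ (d @` `I_(j A).+1)); last exact/finite_image/finite_II.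
move=> s [As [n _ ds]]; exists n => //=; rewrite ltnS leqNgt; apply/negP => jn.
by have [_ _ /(_ A)] := dP n; rewrite ds; apply.
Qed.

(** By maximality an infinite [D] in this set meets some [a A] infinitely often. Then [f (inr A)] is
    a limit of values at distance at least [e] from [c], so [inr A] belongs to the set and
    [compact_psi] applies. *)
Lemma compact_psi_far (c e : R) : finite_set [set A | e <= `|f (inr A) - c|] ->
  compact [set x | e <= `|f x - c|].
Proof.
move=> fin; apply: compact_psi => // D /mad[A AD] KD; exists A => //=.
rewrite leNgt; apply/negP => lt; have e0 : 0 < e - `|f (inr A) - c| by rewrite subr_gt0.
have [s [_ /KD /= Ds fs]] := psi_infinite_near e0 AD.
by have := ler_distD (f (inr A)) (f (inl s)) c; move: Ds fs; lra.
Qed.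

End continuous_functions.

End psi_space_topology.

HB.instance Definition _ (T : choiceType) (a : T -> set (seq bool)) :=
  isPointed.Build (psi_space a) (inl [::]).

Lemma compact_psi_cover (T : choiceType) (a : T -> set (seq bool)) (K : set (psi_space a)) :
  (forall A B, A <> B -> finite_set (a A `&` a B)) -> compact K ->
  exists2 F : set (psi_space a), finite_set F & K `<=` \bigcup_(x in F) psi_ball x.
Proof.
move=> ad; rewrite compact_cover => /(_ _ setT (@psi_ball _ _ a))[].
- by move=> x _; have [] := clopen_psi_ball ad x.
- by move=> x _; exists x => //; exact: psi_ball_refl.
- by move=> F _ KF; eexists; [exact: (finite_fset F)|exact: KF].
Qed.

(** * Indicators of clopen sets and zero-dimensional spaces *)

Section clopen_indicator.
Local Open Scope ring_scope.
Context (R : realType) (X : topologicalType).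

Lemma continuous_clopen_indic (W : set X) :
  clopen W -> continuous (\1_W : X -> R).
Proof.
move=> [oW cW] x; have [Wx|nWx] := pselect (W x); apply: cvg_near_cst.
  have : \forall y \near x, W y by exact: open_nbhs_nbhs.
  by apply: filterS => y Wy; rewrite !indicE !mem_set.
have : \forall y \near x, (~` W) y.
  by apply: open_nbhs_nbhs; split=> //; exact: closed_openC.
by apply: filterS => y Wy; rewrite !indicE !memNset.
Qed.

Lemma clopen_indic_range (W : set X) : range (\1_W : X -> R) `<=` `[0, 1].
Proof.
by move=> _ [x _ <-]; rewrite indicE /= in_itv /=; case: (_ \in _); rewrite /= ?lexx ?ler01.
Qed.

Lemma tychonoff_clopen_base : hausdorff_space X ->
  (forall (U : set X) x, open U -> U x -> exists W, [/\ clopen W, W x & W `<=` U]) ->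
  tychonoff_space X.
Proof.
move=> hX base; split=> // x B cB nBx.
have [W [clW Wx WB]] := base _ _ (closed_openC cB) nBx.
apply/(@uniform_separatorP _ R); exists (\1_(~` W)); split.
- exact/continuous_clopen_indic/clopenC.
- exact: clopen_indic_range.
- by move=> _ [_ -> <-]; rewrite /= indicE memNset //; apply.
- move=> _ [y By <-]; rewrite /= indicE mem_set // => Wy; exact: WB Wy By.
Qed.

End clopen_indicator.

(** * One-point remainders *)

Section sup_initial.
Context (T : choiceType) (V : topologicalType) (I : Type) (h : I -> T -> V).
Let S : topologicalType :=
  sup_topology (fun i => Topological.class (initial_topology (h i))).

(** The topology of the cube in [stone_cech] and the weak topology on [radon_probability] are both
    suprema of this kind. *)
Lemma sup_initial_continuous i : continuous (h i : S -> V).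
Proof.
move=> t; have /cvg_sup/(_ i) it : nbhs (t : S) --> (t : S) by exact: cvg_id.
move=> B Bt; apply: it; exact: (@initial_continuous _ _ (h i) t B Bt).
Qed.

Lemma cvg_sup_initial (F : set_system T) (t : S) : Filter F ->
  (forall i, h i @ F --> h i t) -> F --> t.
Proof.
move=> FF ht; apply/cvg_sup => i B; rewrite nbhsE => -[_ [[W oW <-] Wt] WB].
apply: filterS WB _; apply: (ht i W); exact: open_nbhs_nbhs.
Qed.

End sup_initial.

(** The last hypothesis says that every [f] has a limit along the complements of compact sets; the
    point [p] of the cube with these limits as coordinates is the remainder. *)
Lemma one_point_remainder (R : realType) (X : topologicalType) :
  (forall x : X, exists W, [/\ clopen W, compact W & W x]) ->
  ~ compact [set: X] ->
  (forall f, @cont_unit R X f -> exists c : R, forall e : R, (0 < e)%R ->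
     compact [set x | (e <= `|f x - c|)%R]) ->
  exists p, @stone_cech R X `\` range (@stone_cech_eval R X) = [set p].
Proof.
move=> locK ncX far.
have /choice[p pP] (f : set_type (@cont_unit R X)) : exists c : R, forall e : R, (0 < e)%R ->
    compact [set x | (e <= `|set_val f x - c|)%R] by exact/far/set_valP.
pose S : topologicalType := {ptws set_type (@cont_unit R X) -> R}.
pose ev : X -> S := @stone_cech_eval R X.
have coordC (f : set_type (@cont_unit R X)) : continuous (fun q : S => q f : R).
  exact: (@sup_initial_continuous _ _ _ (fun f (q : S) => q f : R) f).
have evC : continuous ev.
  move=> x; apply: (@cvg_sup_initial _ _ _ (fun f (q : S) => q f : R)) => f.
  have [fC _] := set_valP f; exact: (fC x).
have hS : hausdorff_space S.
  move=> q r qr; apply/funext => f; apply: (@Rhausdorff R) => A B Aq Br.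
  have [s [As Bs]] := qr _ _ (coordC f _ _ Aq) (coordC f _ _ Br).
  by exists (s f).
exists (p : S); apply/seteqP; split=> [q [qcl nq]|_ ->].
  apply: contrapT => qp.
  have [f qpf] : exists f, q f <> p f.
    apply: contrapT => nf; apply: qp; apply/funext => f.
    by apply: contrapT => ?; apply: nf; exists f.
  (* With half the distance as [e], points of the range near [q] come from the compact set [K]. The
     image of [K] is closed and misses [q], a contradiction. *)
  have e0 : (0 < `|q f - p f| / 2)%R by rewrite divr_gt0 // normr_gt0 subr_eq0; exact/eqP.
  set e := (_ / 2)%R in e0; set K := [set x | (e <= `|set_val f x - p f|)%R].
  have cK : compact (ev @` K).
    apply: continuous_compact (pP f e e0); exact: continuous_subspaceT.
  have [s [[x _ <-] [xe nK]]] : (range ev `&` ((fun r : S => r f : R) @^-1` ball (q f : R) e `&`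
      ~` (ev @` K))) !=set0.
    apply: qcl; apply: filterI.
      apply: (coordC f q); exact: nbhsx_ballx.
    apply: open_nbhs_nbhs; split; first by apply: closed_openC; exact: compact_closed.
    by move=> [x _ xq]; apply: nq; exists x.
  apply: nK; exists x => //; rewrite /K /=.
  have {}xe : (`|q f - set_val f x| < e)%R := xe.
  have := ler_distD (set_val f x) (q f) (p f); rewrite -/e.
  by move: xe; rewrite /e; lra.
split.
  (* The filter generated by complements of compact sets; [ev] converges to [p] along it, so [p] is
     in the closure of the range. *)
  pose F : set_system X := [set A | exists2 K, compact K & ~` K `<=` A].
  have FF : ProperFilter F.
    apply: Build_ProperFilter_ex.
      move=> A [K cK KA]; apply: contrapT => nA; apply: ncX.
      rewrite (_ : setT = K) //; apply/seteqP; split=> // x _.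
      by apply: contrapT => nKx; apply: nA; exists x; exact: KA.
    split; first by exists set0 => //; exact: compact0.
      move=> A B [K cK KA] [L cL LB]; exists (K `|` L); first exact: compactU.
      by move=> x nKL; split; [apply: KA|apply: LB] => ?; apply: nKL; [left|right].
    by move=> A B AB [K cK KA]; exists K => //; exact: subset_trans AB.
  have evp : ev @ F --> (p : S).
    apply: (@cvg_sup_initial _ _ _ (fun f (q : S) => q f : R)) => f B /nbhs_ballP[e /= e0 eB].
    exists [set x | (e <= `|set_val f x - p f|)%R]; first exact: pP.
    by move=> x /negP; rewrite -ltNge => xe; apply: eB; rewrite /ball /= distrC.
  move=> B /evp [K cK KB].
  have [x nKx] : exists x, ~ K x.
    apply: contrapT => nK; apply: ncX; rewrite (_ : setT = K) //.
    by apply/seteqP; split=> // x _; apply: contrapT => ?; apply: nK; exists x.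
  by exists (ev x); split; [exists x|exact: KB].
(* The indicator of the compact clopen set [W] is 1 at [x] and 0 off [W]. If [p] were the image of
   [x], its limit would be 1, so the complement of [W] would lie in a compact set and [X] would be
   compact. *)
move=> [x _ xp]; have [W [clW cW Wx]] := locK x.
have fW : @cont_unit R X (\1_W)%R.
  by split; [exact: continuous_clopen_indic|exact: clopen_indic_range].
pose f : set_type (@cont_unit R X) := SigSub (mem_set fW).
have fE y : set_val f y = (y \in W)%:R%R by [].
have pf : p f = 1%R by rewrite -xp /stone_cech_eval fE mem_set.
apply: ncX; rewrite (_ : setT = W `|` [set y | (1 <= `|set_val f y - p f|)%R]).
  by apply: compactU => //; apply: pP.
apply/seteqP; split=> // y _; have [|nWy] := pselect (W y); [by left|right].
by rewrite /= pf fE memNset // sub0r normrN normr1.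
Qed.

Lemma uncountable_cantor : ~ countable [set: nat -> bool].
Proof.
move=> /countable_injP[f finj].
pose x n := `[< exists2 y, f y = n & ~~ y n >].
have [/[dup] xf /asboolP[y fy ny]|nx] := boolP (x (f x)).
  have yx : y = x by apply: finj => //; exact: mem_set.
  by move: ny; rewrite yx xf.
by move: (nx) => /asboolP; apply; exists x.
Qed.

(** * The Mrowka space *)

Lemma countable_setU2 T (A B : set T) :
  countable A -> countable B -> countable (A `|` B).
Proof.
move=> cA cB; have -> : A `|` B = \bigcup_b (if b then A else B).
  by rewrite predeqE => x; split=> [[|]|[[] _]]; [exists true|exists false|left|right].
by apply: bigcup_countable => // -[].
Qed.

Lemma not_thinT : ~ thin setT.
Proof.
move=> [k /(_ k)]; rewrite (eq_card (B := {: k.-tuple bool})); last first.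
  by move=> t; rewrite !unfold_in; apply/asboolP.
by rewrite card_tuple card_bool leqNgt ltn_expl.
Qed.

Lemma thin_psi_cover (T : choiceType) (a : T -> set (seq bool)) (F : set (psi_space a)) :
  (forall A, thin (a A)) -> finite_set F ->
  thin [set s | (\bigcup_(x in F) psi_ball x) (inl s)].
Proof.
move=> tha finF; rewrite -bigsetU_fset_set //.
elim/big_ind : _ => [|U V tU tV|[s|A] _].
- by apply: selector_thin => s [].
- exact: (thinU tU tV).
- by apply: selector_thin => _ _ /= [->] [->].
- rewrite (_ : [set s | _] = a A) //; apply/seteqP; split=> [s [//|[t At [<-]]] //|s As].
  by right; exists s.
Qed.

Lemma not_compact_psi (T : choiceType) (a : T -> set (seq bool)) :
  (forall A B, A <> B -> finite_set (a A `&` a B)) -> (forall A, thin (a A)) ->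
  ~ compact [set: psi_space a].
Proof.
move=> ad tha /(compact_psi_cover ad)[F finF FT]; apply: not_thinT.
rewrite (_ : setT = [set s | (\bigcup_(x in F) psi_ball x) (inl s)]); last first.
  by apply/seteqP; split=> // s _; exact: FT.
exact: thin_psi_cover.
Qed.

Section mrowka.
Local Open Scope ring_scope.

Lemma psi_branch_near (R : realType) (T : choiceType) (a : T -> set (seq bool))
    (f : psi_space a -> R) A x (e : R) :
  continuous f -> branch x `<=` a A -> 0 < e ->
  exists n, forall m, (n <= m)%N -> `|f (inl (mkseq x m)) - f (inr A)| < e.
Proof.
move=> cf xA e0; have finG := finite_psi_far cf A e0.
set G := _ `&` _ in finG.
have /finite_seqP[s sE] := finite_image size finG.
exists (\max_(i <- s) i).+1%N => m nm; rewrite ltNge; apply/negP => em.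
suff : (m <= \max_(i <- s) i)%N by rewrite leqNgt nm.
suff ms : m \in s by exact: leq_bigmax_seq.
suff : [set` s] m by [].
rewrite -sE; exists (mkseq x m); last exact: size_mkseq.
by split=> //; apply: xA; exists m.
Qed.

Lemma mrowka_psi_space (R : realType) :
  exists (T : choiceType) (a : T -> set (seq bool)),
  [/\ forall A B, A <> B -> finite_set (a A `&` a B),
      forall A, thin (a A) & mrowka_space R (psi_space a)].
Proof.
have [A [Ab Aad Amad Aglue]] := mrowka_family.
(* Nonisolated points are indexed by the range of [A], so that glued branches converge to the same
   point. *)
pose T : choiceType := set_type (range A); pose a : T -> set (seq bool) := set_val.
pose cls x : T := SigSub (mem_set (imageT A x)).
have clsP (B : T) : exists x, B = cls x.
  by have [x _ xB] := set_valP B; exists x; apply: val_inj; rewrite /= xB.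
have ad B C : B <> C -> finite_set (a B `&` a C).
  have [[x ->] [y ->]] := (clsP B, clsP C) => xy; apply: Aad => Axy.
  by apply: xy; apply: val_inj.
have inf B : infinite_set (a B).
  have [x ->] := clsP B; have [xA _] := Ab x.
  exact: sub_infinite_set xA (@infinite_branch x).
have tha B : thin (a B) by have [x ->] := clsP B; have [_] := Ab x.
have mad D : infinite_set D -> exists B, infinite_set (a B `&` D).
  by move=> /Amad[x Dx]; exists (cls x).
exists T, a; split=> //; split.
- apply: (@tychonoff_clopen_base R); first exact: hausdorff_psi.
  by move=> U x; exact: psi_clopen_base.
- split; last exact: dense_psi.
  rewrite isolated_psi //; apply: sub_countable (countableP [set: seq bool]).
  exact: card_image_le.
- exact: discrete_psi.
apply: one_point_remainder; first last.
- move=> f [cf f01]; pose F x := f (inr (cls x)).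
  have F01 x : 0 <= F x <= 1.
    by have : `[0, 1]%classic (F x) := f01 _ (imageT f _); rewrite /= in_itv.
  (* The constant is the supremum of the levels below which [F] falls on only countably many
     branches. *)
  pose E := [set t : R | countable [set x | F x < t]].
  have supE : has_sup E.
    split.
      exists 0; apply: (@sub_countable _ _ _ set0); last exact: countable0.
      apply: subset_card_le => x /=; have /andP[F0 _] := F01 x.
      by rewrite ltNge F0.
    exists 1 => t Et; rewrite leNgt; apply/negP => t1; apply: uncountable_cantor.
    apply: sub_countable Et; apply: subset_card_le => x _ /=.
    by have /andP[_ F1] := F01 x; exact: le_lt_trans t1.
  exists (sup E).
  have below t : t < sup E -> countable [set x | F x < t].
    move=> tc; have [|u Eu tu] := @sup_adherent _ E (sup E - t) _ supE.
      by rewrite subr_gt0.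
    apply: sub_countable Eu; apply: subset_card_le => x /= xt.
    by apply: lt_trans xt _; move: tu; rewrite opprB addrC subrK.
  (* Here gluing enters. Otherwise [U] and [V] code uncountable sets, which contain glued [x] and
     [y]. Then [F x = F y], whereas passing to the limit along the branches gives [F x <= m] and
     [F y >= t]. *)
  have above t : sup E < t -> countable [set x | t < F x].
    move=> ct; apply: contrapT => nt; set m := (sup E + t) / 2.
    have [cm mt] : sup E < m /\ m < t by split; rewrite /m; lra.
    have nm : ~ countable [set x | F x < m].
      by move=> Em; have := ub_le_sup supE.2 Em; rewrite leNgt cm.
    pose U := [set s | f (inl s) < m]; pose V := [set s | t < f (inl s)].
    have UF : [set x | F x < m] `<=` prefixes_in U.
      move=> x xm; have e0 : 0 < m - F x by rewrite subr_gt0.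
      have [xA _] := Ab x; have [n nP] := psi_branch_near (A := cls x) cf xA e0.
      exists n => k /nP; rewrite /U /= -/(F x) ltr_norml => /andP[_]; lra.
    have VF : [set x | t < F x] `<=` prefixes_in V.
      move=> x xt; have e0 : 0 < F x - t by rewrite subr_gt0.
      have [xA _] := Ab x; have [n nP] := psi_branch_near (A := cls x) cf xA e0.
      exists n => k /nP; rewrite /V /= -/(F x) ltr_norml => /andP[+ _]; lra.
    have [||x [y [[n xU] [k yV] xy]]] := Aglue U V.
    + by move=> c; apply: nm; apply: sub_countable c; exact: subset_card_le.
    + by move=> c; apply: nt; apply: sub_countable c; exact: subset_card_le.
    have Fxy : F x = F y by congr (f (inr _)); exact: val_inj.
    have [Fm|Fm] := ltP m (F x).
      have e0 : 0 < F x - m by rewrite subr_gt0.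
      have [xA _] := Ab x; have [i iP] := psi_branch_near (A := cls x) cf xA e0.
      have := iP (maxn i n) (leq_maxl _ _); have := xU (maxn i n) (leq_maxr _ _).
      by rewrite /U /= -/(F x) ltr_norml => ? /andP[? ?]; lra.
    have e0 : 0 < t - F y by rewrite -Fxy; lra.
    have [yA _] := Ab y; have [i iP] := psi_branch_near (A := cls y) cf yA e0.
    have := iP (maxn i k) (leq_maxl _ _); have := yV (maxn i k) (leq_maxr _ _).
    by rewrite /V /= -/(F y) ltr_norml => ? /andP[? ?]; lra.
  have cnt e : 0 < e -> countable [set B | e <= `|f (inr B) - sup E|].
    move=> e0; apply: (@sub_countable _ _ _ (cls @`
        ([set x | F x < sup E - e / 2] `|` [set x | sup E + e / 2 < F x]))).
      apply: subset_card_le => B /=; have [x ->] := clsP B => xe; exists x => //=.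
      by move: xe; rewrite -/(F x) ler_normr => /orP[?|?]; [right|left]; lra.
    apply: sub_countable (card_image_le _ _) _; apply: countable_setU2.
      by apply: below; lra.
    by apply: above; lra.
  move=> e e0; apply: compact_psi_far => //.
  exact: (finite_psi_far_countable ad inf mad cf cnt e0).
- exact: not_compact_psi.
- move=> x; exists (psi_ball x); split.
  + exact: clopen_psi_ball.
  + exact: compact_psi_ball.
  + exact: psi_ball_refl.
Qed.

End mrowka.

(** * Radon measures *)

Section locally_finite_sum.
Local Open Scope ring_scope.
Context (R : realType) (Y : topologicalType).

Lemma continuous_sum (I : Type) (r : seq I) (P : pred I) (f : I -> Y -> R) :
  (forall i, P i -> continuous (f i)) ->
  continuous (fun y => \sum_(i <- r | P i) f i y).
Proof.
move=> cf; apply: (@continuous_big R I +%R 0 P) => //; exact: add_continuous.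
Qed.

(** The sum of the [g n] is locally a finite sum, hence continuous, and it dominates every [g n]. *)
Lemma not_pseudocompact_locally_finite (g : nat -> Y -> R) :
  (forall n, continuous (g n)) -> (forall n y, 0 <= g n y) ->
  (forall y : Y, exists N, \forall z \near y, forall n, (N <= n)%N -> g n z = 0) ->
  (forall n, exists y, n%:R <= g n y) ->
  ~ pseudocompact R Y.
Proof.
move=> cg g0 lf unb pc.
have /choice[N NP] y : exists N, forall n, (N <= n)%N -> g n y = 0.
  by have [N Ny] := lf y; exists N; exact: nbhs_singleton Ny.
have sumE y M K : (forall n, (M <= n)%N -> g n y = 0) -> (M <= K)%N ->
    \sum_(n < K) g n y = \sum_(n < M) g n y.
  move=> My MK; rewrite -!(big_mkord xpredT (fun n => g n y)).
  rewrite [LHS](big_cat_nat (n := M)) //= [X in _ + X](_ : _ = 0) ?addr0 //.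
  by rewrite big_nat big1 // => n /andP[/My].
(* The number of summands varies with [y]; by [GE] any valid bound gives the same value, so near a
   given point [G] is one fixed finite sum. *)
pose G y := \sum_(n < N y) g n y.
have GE y M : (forall n, (M <= n)%N -> g n y = 0) -> G y = \sum_(n < M) g n y.
  move=> My; have [MN|NM] := leqP M (N y); first exact: sumE.
  by rewrite (sumE y (N y) M) //; [exact: NP|exact: ltnW].
have cG : continuous G.
  move=> y; have [M My] := lf y.
  rewrite /continuous_at.
  have -> : G y = \sum_(n < M) g n y by apply: GE; exact: nbhs_singleton My.
  apply: (@cvg_trans _ ((fun z => \sum_(n < M) g n z) @ y)); last first.
    by apply: continuous_sum => n _.
  by apply: near_eq_cvg; apply: filterS My => z Mz; rewrite (GE z M).
have [M [M0 Mb]] := pinfty_ex_gt0 (pc _ cG).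
have [y yn] := unb (Num.truncn M).+1.
have : `|G y| <= M := Mb y I.
apply/negP; rewrite -ltNge; apply: lt_le_trans (truncnS_gt M) _.
apply: le_trans yn _; apply: le_trans (ler_norm _).
have [nN|Nn] := ltnP (Num.truncn M).+1 (N y); last by rewrite (NP _ _ Nn) sumr_ge0.
by rewrite /G (bigD1 (Ordinal nN)) //= lerDl sumr_ge0.
Qed.

End locally_finite_sum.

Lemma mnormalizeE d (T : measurableType d) (R : realType)
    (mu : measure T R) (P : probability T R) (B : set T) (r : R) :
  mu setT = r%:E -> r != 0%R -> mnormalize mu P B = (mu B * (r^-1)%:E)%E.
Proof. by move=> muT r0; rewrite /mnormalize muT eqe (negbTE r0). Qed.

(** * Radon probability measures on Psi-spaces *)

Section radon_psi.
Local Open Scope ring_scope.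
Context (R : realType) (T : choiceType) (a : T -> set (seq bool)).
Context (ad : forall A B, A <> B -> finite_set (a A `&` a B)).
Context (tha : forall A, thin (a A)).
Local Notation X := (psi_space a).
Implicit Types (mu : radon_probability R X) (B C : set X).

(** Any set of points [inl s] is open and any set of points [inr A] is closed, so every set is
    Borel. *)
Lemma measurable_psi (B : set (borel X)) : measurable B.
Proof.
have openM (U : set X) : open U -> measurable (U : set (borel X)).
  by move=> oU; exact: sub_sigma_algebra.
have -> : B = (B `&` range inl) `|` ~` (~` B `|` range inl) :> set (borel X).
  apply/seteqP; split=> x.
    have [xl Bx|xl Bx] := pselect (range inl x); first by left.
    by right => -[|].
  by case=> [[]//|nx]; apply: contrapT => nB; apply: nx; left.
apply: measurableU; first by apply: openM; apply: open_psi_inl => x [].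
apply: measurableC; apply: openM; rewrite psi_openE => A _.
apply: sub_finite_set (finite_set0 _) => s [_]; apply.
by right; exists s.
Qed.

Definition mass (mu : radon_probability R X) (B : set X) : R :=
  fine (set_val mu B).

Lemma massE mu B : set_val mu B = (mass mu B)%:E.
Proof. by rewrite /mass fineK // fin_num_measure //; exact: measurable_psi. Qed.

Lemma mass_ge0 mu B : 0 <= mass mu B.
Proof. by rewrite /mass fine_ge0. Qed.

Lemma massU mu B C : B `&` C = set0 -> mass mu (B `|` C) = mass mu B + mass mu C.
Proof.
move=> BC; apply: EFin_inj; rewrite EFinD -!massE measureU //; exact: measurable_psi.
Qed.

Lemma sum_mass_le mu (s : seq X) B : uniq s -> (forall x, x \in s -> B x) ->
  \sum_(x <- s) mass mu [set x] <= mass mu B.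
Proof.
elim: s B => [|x s IH] B /=; first by rewrite big_nil mass_ge0.
move=> /andP[xs us] sB; rewrite big_cons.
have -> : B = [set x] `|` (B `\` [set x]).
  apply/seteqP; split=> y; last by case=> [->|[]//]; apply: sB; rewrite mem_head.
  by move=> By; have [->|yx] := pselect (y = x); [left|right].
rewrite massU; last by rewrite setDE setICA setICr setI0.
rewrite lerD2l; apply: IH => // y ys; split; first by apply: sB; rewrite inE ys orbT.
by move=> yx; move: xs; rewrite -yx ys.
Qed.

(** The mass of [W] is the integral of its indicator, which is bounded and continuous because [W] is
    clopen. *)
Lemma continuous_mass (W : set X) : clopen W -> continuous (mass ^~ W).
Proof.
move=> clW; have bW : @cont_bounded R X (\1_W).
  split; first exact: continuous_clopen_indic.
  exists 1; split=> // M M1 x _ /=.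
  by rewrite indicE; case: (_ \in _); rewrite ?normr1 ?normr0; lra.
have -> : mass ^~ W = @radon_integral R X \1_W.
  apply/funext => mu; rewrite /radon_integral /Rintegral integral_indic //.
    by rewrite setIT.
  exact: measurable_psi.
exact: (@sup_initial_continuous _ _ _ (fun f : set_type (@cont_bounded R X) =>
  radon_integral (set_val f)) (SigSub (mem_set bW))).
Qed.

(* The truncation at [2 ^- n] keeps [spread n] small on measures concentrated on
   few nodes of level [n]; it equals [1] at the uniform measure on that level. *)
Definition spread (n : nat) (mu : radon_probability R X) : R :=
  \sum_(t : n.-tuple bool) Num.min (mass mu [set inl (tval t)]) (2 ^- n).

Lemma continuous_spread n : continuous (spread n).
Proof.
apply: continuous_sum => t _ mu.
apply: (@continuous_min _ _ (mass ^~ [set inl (tval t)]) (cst (2 ^- n))).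
  by apply: continuous_mass; exact: clopen_psi_inl.
exact: cst_continuous.
Qed.

(** Terms of nodes in [W] are bounded by the truncation, the others by their mass, which adds up to
    at most that of the complement. *)
Lemma spread_le n mu (W : set X) k :
  (#|[pred t : n.-tuple bool | `[< W (inl (tval t)) >]]| <= k)%N ->
  spread n mu <= k%:R * 2 ^- n + mass mu (~` W).
Proof.
move=> Wk; rewrite /spread (bigID (fun t : n.-tuple bool => `[< W (inl (tval t)) >])) /=.
apply: lerD.
  apply: (@le_trans _ _ (\sum_(t : n.-tuple bool | `[< W (inl (tval t)) >]) 2 ^- n)).
    by apply: ler_sum => t _; rewrite ge_min lexx orbT.
  rewrite sumr_const -[X in X <= _]mulr_natl ler_wpM2r ?invr_ge0 ?exprn_ge0 // ler_nat.
  by apply: leq_trans Wk; rewrite eq_leq //; apply: eq_card => t.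
apply: (@le_trans _ _ (\sum_(t : n.-tuple bool | ~~ `[< W (inl (tval t)) >])
    mass mu [set inl (tval t)])).
  by apply: ler_sum => t _; rewrite ge_min lexx.
rewrite -big_filter -(big_map (fun t : n.-tuple bool => inl (tval t) : X) xpredT
  (fun x => mass mu [set x])).
apply: sum_mass_le.
  rewrite map_inj_uniq ?filter_uniq // ?index_enum_uniq // => t u [].
  exact: val_inj.
move=> x /mapP[t]; rewrite mem_filter => /andP[/asboolP tW _] -> //.
Qed.

(** A compact set missing less than 1/4 of [mu] lies in a finite union [W] of balls, which is clopen
    and has a thin set of nodes. Having mass below 1/4 outside [W] is an open condition, and the at
    most [k] nodes of [W] on level [n] add at most [k / 2 ^ n]. *)
Lemma spread_small mu : exists N, \forall nu \near mu,
  forall n, (N <= n)%N -> spread n nu <= 1 / 2.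
Proof.
have [mu_radon _] := set_valP mu.
have [K [cK _ KT]] := mu_radon setT (measurable_psi _) (1 / 4) ltac:(lra).
have [F finF KF] := compact_psi_cover ad cK.
set W := \bigcup_(x in F) psi_ball x in KF.
have clW : clopen W.
  split; first by apply: bigcup_open => x _; have [] := clopen_psi_ball ad x.
  by apply: closed_bigcup => // x _; have [] := clopen_psi_ball ad x.
have [k Wk] := thin_psi_cover tha finF.
have [N NP] : exists N, forall n, (N <= n)%N -> k%:R * 2 ^- n <= 1 / 4 :> R.
  exists (4 * k)%N => n kn; rewrite ler_pdivrMr ?exprn_gt0 //.
  have : (4 * k)%:R <= (2 ^ n)%:R :> R.
    by rewrite ler_nat (leq_trans kn) // ltnW // ltn_expl.
  by rewrite natrM natrX; lra.
have muW : mass mu (~` W) < 1 / 4.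
  rewrite -lte_fin -massE; apply: le_lt_trans KT.
  apply: le_measure; rewrite ?inE; [exact: measurable_psi|exact: measurable_psi|].
  by move=> x nWx; split=> // Kx; apply: nWx; exact: KF.
exists N; have : \forall nu \near mu, mass nu (~` W) < 1 / 4.
  have cW := continuous_mass (clopenC setT clW).
  by apply: (cW mu [set r | r < 1 / 4]); exact: lt_nbhsl.
apply: filterS => nu nuW n Nn.
have := @spread_le n nu W k (Wk n); have := NP n Nn; lra.
Qed.

(** * Uniform measures on the levels of the tree *)

Section uniform_measure.
Variable n : nat.

(** The counting measure of level [n]; the level is listed because [msum] runs over natural
    numbers. *)
Definition uniform_sum : set (borel X) -> \bar R :=
  msum (fun i => dirac (inl (nth [::] (map (@tval n bool) (enum {: n.-tuple bool})) i) : borel X))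
    (size (map (@tval n bool) (enum {: n.-tuple bool}))).

HB.instance Definition _ := Measure.on uniform_sum.

Lemma uniform_sumE B : uniform_sum B =
  (\sum_(t : n.-tuple bool) (inl (tval t) \in B)%:R)%:E.
Proof.
rewrite /uniform_sum /msum /= -(big_mkord xpredT (fun i =>
  \d_(inl (nth [::] (map (@tval n bool) (enum {: n.-tuple bool})) i) : borel X) B)).
rewrite -(big_nth [::] xpredT (fun s => \d_(inl s : borel X) B)) big_map.
rewrite big_enum /= sumEFin; congr EFin; exact: eq_bigr.
Qed.

(** The Dirac measure is the fallback of [mnormalize] for total mass zero or infinity; here the
    total mass is [2 ^+ n]. *)
Definition uniform_level : probability (borel X) R :=
  mnormalize uniform_sum (dirac (inl [::] : borel X)).

Lemma uniform_levelE B : uniform_level B =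
  ((\sum_(t : n.-tuple bool) (inl (tval t) \in B)%:R) * 2 ^- n)%:E.
Proof.
have sumT : uniform_sum setT = (2 ^+ n)%:E.
  rewrite uniform_sumE; under eq_bigr do rewrite in_setT.
  by rewrite sumr_const card_tuple card_bool natrX.
have n0 : 2 ^+ n != 0 :> R by rewrite expf_neq0.
transitivity (uniform_sum B * ((2 ^+ n)^-1)%:E)%E; first exact: mnormalizeE.
by rewrite uniform_sumE EFinM.
Qed.

(** The measure lives on a finite level, so the part of [B] on that level is compact and leaves a
    null set. *)
Lemma uniform_level_radon : @is_radon_probability R X uniform_level.
Proof.
split; last by move=> B []; exact: measurable_psi.
move=> B _ e e0; exists (B `&` (inl @` [set s : seq bool | size s = n])); split.
- apply: finite_compact; apply: finite_setIr; apply: finite_image; exact: finite_level.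
- by move=> x [].
- rewrite uniform_levelE big1 ?mul0r ?lte_fin // => t _.
  rewrite memNset // => -[Bt]; apply; split=> //.
  by exists (tval t) => //=; rewrite size_tuple.
Qed.

End uniform_measure.

Lemma not_pseudocompact_radon_psi :
  ~ pseudocompact R (radon_probability R X).
Proof.
(* Cutting off at 1/2 gives local finiteness by [spread_small]. The uniform measure on level [n] has
   spread 1, where the factor [2 * n] produces the value [n]. *)
apply: (@not_pseudocompact_locally_finite _ _
  (fun n mu => (2 * n%:R) * Num.max 0 (spread n mu - 1 / 2))).
- move=> n mu.
  apply: (@continuousM _ _ (cst (2 * n%:R)) (fun nu => Num.max 0 (spread n nu - 1 / 2))).
    exact: cst_continuous.
  apply: (@continuous_max _ _ (cst 0) (fun nu => spread n nu - 1 / 2)).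
    exact: cst_continuous.
  apply: (@continuousB _ _ _ (spread n) (cst (1 / 2))); last exact: cst_continuous.
  exact: (@continuous_spread n mu).
- by move=> n mu; rewrite mulr_ge0 // le_max lexx.
- move=> mu; have [N muN] := spread_small mu; exists N.
  apply: filterS muN => nu nuN n /nuN nu2.
  by rewrite max_l ?mulr0 // subr_le0.
- move=> n; pose mu : radon_probability R X := SigSub (mem_set (uniform_level_radon n)).
  exists mu; have -> : spread n mu = 1.
    rewrite /spread (eq_bigr (fun=> 2 ^- n)); last first.
      move=> t _; rewrite (_ : mass mu _ = 2 ^- n) ?minxx //.
      apply: EFin_inj; rewrite -massE /mu /= uniform_levelE.
      rewrite (bigD1 t) //= mem_set // big1 ?addr0 ?mul1r // => u ut.
      rewrite memNset // => -[] /val_inj utE; by rewrite utE eqxx in ut.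
    by rewrite sumr_const card_tuple card_bool -[LHS]mulr_natl natrX divff ?expf_neq0.
  rewrite max_r; last by lra.
  by have := ler0n R n; nra.
Qed.

End radon_psi.

Theorem theorem5p6 (R : realType) :
  exists X : ptopologicalType,
    mrowka_space R X /\ ~ pseudocompact R (radon_probability R X).
Proof.
have [T [a [ad tha mrowka]]] := mrowka_psi_space R.
by exists (psi_space a); split=> //; exact: not_pseudocompact_radon_psi.
Qed.
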